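(* Let $\Gamma=(\mathcal V,b,c)$ be a weighted graph over $(\mathcal V,m)$ and suppose $$\sup_{\mathcal K\subset\mathcal V:\ \operatorname{diam}_d(\mathcal K)<\infty}\ \inf_{x\in\mathcal V\setminus\mathcal K}\big(c(x)+m(x)\big)>0.$$ Then $D(q^{(N)})\hookrightarrow\ell^\infty$, i.e. $D(q^{(N)})$ is continuously embedded in $\ell^\infty$.
   Context: Let $\mathcal V$ be an infinite countable set and $m:\mathcal V\to(0,\infty)$; put $m(A)=\sum_{x\in A}m(x)$ for $A\subset\mathcal V$. A weighted graph $\Gamma=(\mathcal V,b,c)$ over $(\mathcal V,m)$ consists of an edge weight $b:\mathcal V\times\mathcal V\to[0,\infty)$ with $b(x,x)=0$, $b(x,y)=b(y,x)$, $\sum_{y}b(x,y)<\infty$ for all $x,y\in\mathcal V$, and a killing term $c:\mathcal V\to[0,\infty)$. Write $x\sim y$ iff $b(x,y)>0$. Put $V(x)=\frac{c(x)+m(x)}{m(x)}\ge 1$. $\ell^2_m$ is the space of $u:\mathcal V\to\mathbb R$ with $\sum_x m(x)|u(x)|^2<\infty$; $\ell^\infty$ is the space of bounded functions with sup-norm. $q^{(N)}(u)=\frac12\sum_{x,y\in\mathcal V,\,x\sim y}b(x,y)(u(y)-u(x))^2+\sum_x m(x)V(x)u(x)^2$ with domain $D(q^{(N)})=\{u\in\ell^2_m: q^{(N)}(u)<\infty\}$, normed by $q^{(N)}(u)^{1/2}$. $d(x,y)=\inf\{\sum_{i=1}^n\frac1{b(x_{i-1},x_i)}\}$, the infimum over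 all paths $(x_0,\dots,x_n)$ from $x$ to $y$, i.e. $x_0=x$, $x_n=y$ and $b(x_{i-1},x_i)>0$ (with $d(x,x)=0$ and $d(x,y)=\infty$ if there is no path); $\operatorname{diam}_d(\mathcal K)=\sup_{x,y\in\mathcal K}d(x,y)$. Convention: $\inf\emptyset=+\infty$. Standing assumption of the paper: $\sup_{\mathcal K\Subset\mathcal V,\ m(\mathcal K)<\infty}\ \inf_{x\in\mathcal V\setminus\mathcal K}V(x)=\infty$, where $\mathcal K\Subset\mathcal V$ means that $u\mapsto\chi_{\mathcal K}u$ is a continuous operator $D(q^{(N)})\to\ell^\infty$. *)

(* Defs.v *)
From HB Require Import structures.
From mathcomp Require Import all_boot all_order all_algebra.
From mathcomp Require Import all_classical all_reals all_analysis.
Set Implicit Arguments.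
Unset Strict Implicit.
Unset Printing Implicit Defensive.
Import Order.TTheory GRing.Theory Num.Theory.
Local Open Scope classical_set_scope.
Local Open Scope ring_scope.
Local Open Scope ereal_scope.

Record weighted_graph (R : realType) (V : countType) := WeightedGraph {
  edge : V -> V -> R;
  kill : V -> R;
  edge_ge0 : forall x y, (0 <= edge x y)%R;
  edge_irrefl : forall x, edge x x = 0%R;
  edge_sym : forall x y, edge x y = edge y x;
  edge_summable : forall x, \esum_(y in [set: V]) (edge x y)%:E < +oo;
  kill_ge0 : forall x, (0 <= kill x)%R
}.

Section WeightedGraphs.
Variables (R : realType) (V : countType) (m : V -> R) (G : weighted_graph R V).
Implicit Types (x y : V) (u v : V -> R) (K : set V).

Local Notation b := (edge G).
Local Notation c := (kill G).

Definition vol K : \bar R := \esum_(x in K) (m x)%:E.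

Definition adj : rel V := fun x y => (0 < b x y)%R.

Definition pot x : R := ((c x + m x) / m x)%R.

Definition ell2 : set (V -> R) :=
  [set u | \esum_(x in [set: V]) (m x * `|u x| ^+ 2)%:E < +oo].

Definition linfty_norm u : \bar R := ereal_sup [set `|u x|%:E | x in [set: V]].

Definition ell_infty : set (V -> R) := [set u | linfty_norm u < +oo].

Definition qN u : \bar R :=
  (2^-1)%:E * (\esum_(e in [set e : V * V | adj e.1 e.2])
                 (b e.1 e.2 * (u e.2 - u e.1) ^+ 2)%:E)
  + \esum_(x in [set: V]) (m x * pot x * u x ^+ 2)%:E.

Definition dom_qN : set (V -> R) := [set u | ell2 u /\ qN u < +oo].

Definition qN_norm u : \bar R := sqrte (qN u).

(* Continuity, at every point, of [T] as a map from the normed space D(qN) to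
   the normed space ell_infty. The norms are extended-real-valued on all
   functions, but they are finite on the differences occurring here because
   D(qN) and ell_infty are vector spaces. [T] is meant to be linear, as are the
   two instances below. *)
Definition continuous_to_linfty (T : (V -> R) -> V -> R) : Prop :=
  (forall u, dom_qN u -> ell_infty (T u)) /\
  (forall u, dom_qN u -> forall e : R, (0 < e)%R ->
     exists2 r : R, (0 < r)%R &
       forall v, dom_qN v -> qN_norm (v \- u)%R < r%:E ->
         linfty_norm (T v \- T u)%R < e%:E).

Definition dom_qN_embeds_linfty : Prop := continuous_to_linfty id.

Definition admissible K : Prop :=
  continuous_to_linfty (fun u => fun x => (\1_K x * u x)%R).

(* The vertex sequence (x, p_0, ..., p_{k-1}); the empty [p] is the trivial
   path at [x], so that [gdist x x = 0]. *)
Definition path_length x (p : seq V) : R :=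
  (\sum_(l <- pairmap (fun y z => (b y z)^-1) x p) l)%R.

Definition gdist x y : \bar R :=
  ereal_inf [set (path_length x p)%:E | p in
               [set p : seq V | path adj x p /\ last x p = y]].

(* Equal to -oo, hence still < +oo, for K empty. *)
Definition gdiam K : \bar R :=
  ereal_sup [set gdist z.1 z.2 | z in K `*` K].

Definition pot_unbounded : Prop :=
  ereal_sup [set ereal_inf [set (pot x)%:E | x in ~` K] | K in
               [set K | admissible K /\ vol K < +oo]] = +oo.

End WeightedGraphs.

(* Main.v *)
Require Import Defs.
From mathcomp Require Import all_boot all_order all_algebra.
From mathcomp Require Import all_classical all_reals all_analysis.
From mathcomp Require Import ring lra.
Import Order.TTheory GRing.Theory Num.Theory.
Local Open Scope classical_set_scope.
Local Open Scope ring_scope.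
Local Open Scope ereal_scope.

(** Let [K] be a set of finite diameter with [c + m >= delta > 0] off [K]. Off
    [K], one term of the potential part of [qN u] already gives
    [delta * u x ^+ 2 <= qN u]. On [K], fix a vertex [x0]; by Cauchy-Schwarz
    along a path of bounded length from [x0] to [x],
    [(u x - u x0) ^+ 2 <= length * energy of the path], and the energy of a path
    without repeated vertices is at most [2 * qN u]. *)

Section Embedding.
Set Implicit Arguments.
Unset Strict Implicit.
Local Open Scope ring_scope.
Variables (R : realType) (V : countType) (m : V -> R) (G : weighted_graph R V).
Hypothesis m_gt0 : forall x, 0 < m x.

Local Notation b := (edge G).
Local Notation c := (kill G).

Lemma esum_ge_seq (T : choiceType) (S : set T) (f : T -> R) (s : seq T) :
  uniq s -> (forall t, t \in s -> S t) ->
  ((\sum_(t <- s) f t)%:E <= \esum_(t in S) (f t)%:E)%E.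
Proof.
move=> s_uniq sS; apply: esum_ge; exists [set` s]; first by split.
by rewrite -fsbig_seq// sumEFin.
Qed.

Lemma path_length_ge0 x p : 0 <= path_length G x p.
Proof.
rewrite /path_length; elim: p x => [|y p IH] x /=; first by rewrite big_nil.
by rewrite big_cons addr_ge0// invr_ge0 edge_ge0.
Qed.

Lemma path_length_cons x y p :
  path_length G x (y :: p) = (b x y)^-1 + path_length G y p.
Proof. by rewrite /path_length /= big_cons. Qed.

Lemma path_length_cat x p1 p2 : path_length G x (p1 ++ p2) =
  path_length G x p1 + path_length G (last x p1) p2.
Proof. by rewrite /path_length pairmap_cat big_cat. Qed.

(** By induction on the tail: if the next vertex [y] recurs in the shortened tail, the loop before
    its recurrence is cut out, which removes only nonnegative lengths. The start [x] may still recur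
    in [p']. *)
Lemma shorter_uniq_path x p : path (adj G) x p ->
  exists p', [/\ path (adj G) x p', last x p' = last x p, uniq p' &
                 path_length G x p' <= path_length G x p].
Proof.
elim: p x => [|y p IH] x /=; first by exists [::].
move=> /andP[xy /IH[p' [p'path p'last p'uniq p'len]]].
have [yp'|yp'] := boolP (y \in p'); last first.
  exists (y :: p'); split => //=; rewrite ?xy ?yp'//.
  by rewrite !path_length_cons lerD2l.
case/splitPr: yp' p'path p'last p'uniq p'len => p1 p2.
rewrite cat_path last_cat cat_uniq /= => /and3P[_ _ p2path] p2last.
move=> /and4P[_ _ yp2 p2uniq]; rewrite path_length_cat path_length_cons => len.
exists (y :: p2); split => //=; rewrite ?xy ?yp2//.
rewrite !path_length_cons lerD2l (le_trans _ len)// addrA lerDr.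
by rewrite addr_ge0 ?path_length_ge0// invr_ge0 edge_ge0.
Qed.

Definition path_energy (u : V -> R) x p : R :=
  \sum_(e <- pairmap pair x p) b e.1 e.2 * (u e.2 - u e.1) ^+ 2.

Lemma path_energy_ge0 u x p : 0 <= path_energy u x p.
Proof. by apply: sumr_ge0 => e _; rewrite mulr_ge0 ?edge_ge0 ?sqr_ge0. Qed.

(** Cauchy-Schwarz with factors [b^(-1/2)] and [b^(1/2)] times the increment, by induction on the
    path: once the first edge is split off, only the cross term of the square remains to be
    absorbed. *)
Lemma sqr_incr_le_path_energy u x p : path (adj G) x p ->
  (u (last x p) - u x) ^+ 2 <= path_length G x p * path_energy u x p.
Proof.
elim: p x => [|y p IH] x /=.
  by move=> _; rewrite subrr expr0n mulr_ge0 ?path_length_ge0 ?path_energy_ge0.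
move=> /andP[bxy /IH]; rewrite path_length_cons /path_energy /= big_cons /=.
rewrite -/(path_energy u y p).
have := path_length_ge0 y p; have := path_energy_ge0 u y p.
move: (path_energy u y p) (path_length G y p) => E L E0 L0.
rewrite -[u (last y p) - u x](subrKA (u y)).
move: (u (last y p) - u y) (u y - u x) => s a sLE.
rewrite /adj in bxy; move: (b x y) bxy => w w0.
rewrite mulrDl !mulrDr mulKf ?gt_eqF// sqrrD.
(* AM-GM: [2 s a <= L w a^2 + E / w], since [s^2 <= L E]. *)
have amgm : (s * a) *+ 2 <= w^-1 * E + L * (w * a ^+ 2).
  have P0 : 0 <= w^-1 * E by rewrite mulr_ge0// invr_ge0 ltW.
  have Q0 : 0 <= L * (w * a ^+ 2) by rewrite mulr_ge0// mulr_ge0 ?sqr_ge0// ltW.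
  have PQ : (w^-1 * E) * (L * (w * a ^+ 2)) = L * E * a ^+ 2.
    by field; rewrite gt_eqF.
  have := ler_wpM2r (sqr_ge0 a) sLE; rewrite -PQ.
  move: (w^-1 * E) (L * (w * a ^+ 2)) P0 Q0 {PQ} => P Q P0 Q0 saPQ.
  apply: le_trans (ler_norm _) _.
  rewrite -ler_sqr ?nnegrE ?addr_ge0// real_normK ?num_real//.
  rewrite exprMn_n; have := sqr_ge0 (P - Q); lra.
lra.
Qed.

Lemma energy_ge0 u :
  (0 <= \esum_(e in [set e : V * V | adj G e.1 e.2])
     (b e.1 e.2 * (u e.2 - u e.1) ^+ 2)%:E)%E.
Proof.
by apply: esum_ge0 => e _; rewrite lee_fin mulr_ge0 ?edge_ge0 ?sqr_ge0.
Qed.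

Lemma potential_energy_ge0 u :
  (0 <= \esum_(x in [set: V]) (m x * pot m G x * u x ^+ 2)%:E)%E.
Proof.
apply: esum_ge0 => x _; rewrite lee_fin mulr_ge0 ?sqr_ge0// mulr_ge0 ?ltW//.
by rewrite divr_gt0// ltr_wpDl ?kill_ge0.
Qed.

Lemma qN_ge0 u : (0 <= qN m G u)%E.
Proof.
by rewrite adde_ge0 ?mule_ge0 ?energy_ge0 ?potential_energy_ge0// lee_fin invr_ge0.
Qed.

Lemma qN_ge_vertex u q x : (qN m G u <= q%:E)%E -> (c x + m x) * u x ^+ 2 <= q.
Proof.
rewrite -lee_fin; apply: le_trans.
apply: (@le_trans _ _ (\esum_(x in [set: V]) (m x * pot m G x * u x ^+ 2)%:E)%E).
  2: by rewrite leeDr// mule_ge0 ?energy_ge0// lee_fin invr_ge0.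
have /= := @esum_ge_seq V setT (fun x => m x * pot m G x * u x ^+ 2) [:: x]
  isT (fun _ _ => I).
by rewrite big_seq1 /pot mulrC [m x * _]mulrC divfK ?gt_eqF// mulrC.
Qed.

(** The edges of the path are distinct terms of the energy sum because their second end points, the
    entries of [p], are distinct. The factor 2 undoes the [2^-1] in [qN]. *)
Lemma qN_ge_path u q x p : path (adj G) x p -> uniq p ->
  (qN m G u <= q%:E)%E -> path_energy u x p <= 2 * q.
Proof.
move=> xp p_uniq qq; rewrite -lee_fin EFinM -lee_pdivrMl//; apply: le_trans qq.
apply: le_trans (leeDl _ (potential_energy_ge0 u)).
rewrite lee_pmul2l ?lte_fin ?invr_gt0//; apply: esum_ge_seq.
  rewrite (@map_uniq _ _ snd)//.
  suff -> : map snd (pairmap pair x p) = p by [].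
  by elim: p x {xp p_uniq} => //= y p IH x; rewrite IH.
elim: p x xp {p_uniq} => //= y p IH x /andP[xy /IH{}IH] e.
by rewrite inE => /predU1P[->//|/IH].
Qed.

(** The infimum [gdist] need not be attained; the strict bound [L] yields an actual path shorter
    than [L]. *)
Lemma qN_ge_incr u q x y (L : R) : (gdist G x y < L%:E)%E ->
  (qN m G u <= q%:E)%E -> (u y - u x) ^+ 2 <= 2 * L * q.
Proof.
move=> /ereal_inf_lt[_ [p [xp lastp] <-]]; rewrite lte_fin => pL qq.
have [p' [xp' lastp' p'uniq p'p]] := shorter_uniq_path xp.
rewrite -lastp -lastp' (le_trans (sqr_incr_le_path_energy u xp'))//.
rewrite mulrAC mulrC ler_pM ?path_length_ge0 ?path_energy_ge0//.
  exact: qN_ge_path.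
exact: le_trans p'p (ltW pL).
Qed.

Hypothesis lower_bound :
  (0 < ereal_sup [set ereal_inf [set (c x + m x)%:E | x in ~` K] | K in
                    [set K : set V | gdiam G K < +oo]])%E.

(** A real bound [q] in place of [qN u] keeps the estimates in [R]. The normalization [1 <= C] later
    gives [C^-1 <= 1]. *)
Lemma uniform_qN_bound : exists2 C : R, 1 <= C &
  forall u q x, (qN m G u <= q%:E)%E -> u x ^+ 2 <= C * q.
Proof.
have [_ [K /= Kdiam <-] Kinf] := ereal_sup_gt lower_bound.
have [d d0 dK] : exists2 d : R, 0 < d & forall x, ~ K x -> d <= c x + m x.
  have infK x : ~ K x ->
      (ereal_inf [set (c x + m x)%:E | x in ~` K] <= (c x + m x)%:E)%E.
    by move=> Kx; apply: ereal_inf_lbound; exists x.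
  (* The infimum is [+oo] only if [K] is everything; then any positive [d] will do. *)
  case: (ereal_inf _) Kinf infK => [d|_|//].
    by rewrite lte_fin => d0 infK; exists d => // x /infK; rewrite lee_fin.
  by move=> infK; exists 1 => // x /infK; rewrite leye_eq.
have q_ge0 u q : (qN m G u <= q%:E)%E -> 0 <= q.
  by rewrite -lee_fin; apply: le_trans (qN_ge0 u).
have offK u q x : (qN m G u <= q%:E)%E -> ~ K x -> u x ^+ 2 <= d^-1 * q.
  move=> qq /dK dx; rewrite ler_pdivlMl//.
  by apply: le_trans (qN_ge_vertex x qq); rewrite ler_wpM2r// sqr_ge0.
have [K0|/set0P[x0 Kx0]] := eqVneq K set0.
  exists (1 + d^-1); first by rewrite lerDl invr_ge0 ltW.
  move=> u q x qq; rewrite (le_trans (offK _ _ x qq _)) ?K0//.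
  by rewrite ler_wpM2r ?(q_ge0 u)// lerDr.
have [L L0 KL] : exists2 L : R, 0 <= L &
    forall x, K x -> (gdist G x0 x < L%:E)%E.
  have diamK x : K x -> (gdist G x0 x <= gdiam G K)%E.
    by move=> Kx; apply: ereal_sup_ubound; exists (x0, x).
  (* Adding 1 to the diameter makes the bound strict; the absolute value makes it nonnegative. *)
  case: (gdiam G K) Kdiam diamK => [D _ diamK|//|_ diamK].
    exists (`|D| + 1) => [|x /diamK /le_lt_trans]; first by rewrite addr_ge0.
    by apply; rewrite lte_fin (le_lt_trans (ler_norm D))// ltrDl.
  by exists 0 => // x /diamK; rewrite leeNy_eq => /eqP ->; rewrite ltNyr.
have m0 := m_gt0 x0; have c0 := kill_ge0 G x0.
(* The summand 1 ensures [1 <= C], [d^-1] serves the vertices off [K], and the other two come from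
   [u x ^+ 2 <= 2 * (u x - u x0) ^+ 2 + 2 * u x0 ^+ 2] on [K]. *)
exists (1 + d^-1 + 2 * (m x0)^-1 + 4 * L).
  by move: d0 m0; rewrite -invr_gt0 -[0 < m x0]invr_gt0; lra.
move=> u q x qq; have q0 := q_ge0 u q qq.
have dq : 0 <= d^-1 * q by rewrite mulr_ge0// invr_ge0 ltW.
have mq : 0 <= (m x0)^-1 * q by rewrite mulr_ge0// invr_ge0 ltW.
have Lq : 0 <= L * q by rewrite mulr_ge0.
have [Kx|Kx] := pselect (K x); last by have := offK u q x qq Kx; lra.
have ux := qN_ge_incr (KL x Kx) qq.
have ux0 : u x0 ^+ 2 <= (m x0)^-1 * q.
  rewrite ler_pdivlMl//; apply: le_trans (qN_ge_vertex x0 qq).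
  by rewrite ler_wpM2r ?sqr_ge0// lerDr.
(* Expanding this square gives exactly the splitting of [u x ^+ 2] through [x0]. *)
have := sqr_ge0 (u x - u x0 *+ 2); lra.
Qed.

Lemma linfty_norm_le (u : V -> R) (a : R) :
  0 <= a -> (forall x, u x ^+ 2 <= a ^+ 2) -> (linfty_norm u <= a%:E)%E.
Proof.
move=> a0 ua; apply: ge_ereal_sup => _ [x _ <-]; rewrite lee_fin.
by rewrite -ler_sqr ?nnegrE// real_normK ?num_real.
Qed.

End Embedding.

Theorem proposition3p6 (R : realType) (V : countType) (m : V -> R)
    (G : weighted_graph R V)
    (V_infinite : infinite_set [set: V])
    (m_gt0 : forall x : V, (0 < m x)%R)
    (standing : pot_unbounded m G)
    (lower_bound :
       0 < ereal_sup [set ereal_inf [set (kill G x + m x)%:E | x in ~` K] | K in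
                        [set K : set V | gdiam G K < +oo]]) :
  dom_qN_embeds_linfty m G.
Proof.
have [C C1 qC] := uniform_qN_bound m_gt0 lower_bound.
split=> [u [_ uq]|u _ e e0].
  have /qC{}qC : qN m G u <= (fine (qN m G u))%:E.
    by rewrite fineK// ge0_fin_numE// qN_ge0.
  set q := fine _ in qC.
  have Cq : (0 <= C * q)%R.
    by rewrite mulr_ge0 ?fine_ge0 ?qN_ge0// (le_trans ler01).
  rewrite /ell_infty /= (@le_lt_trans _ _ (Num.sqrt (C * q))%:E) ?ltry//.
  by apply: linfty_norm_le => [|x]; rewrite ?sqrtr_ge0// sqr_sqrtr.
have C0 : (0 < C)%R by apply: lt_le_trans C1.
have r0 : (0 < e / (2 * C))%R by rewrite divr_gt0 ?mulr_gt0.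
(* With this radius the squared values are at most [C * r ^+ 2 = C^-1 * (e / 2) ^+ 2]; halving [e]
   makes the final inequality strict. *)
exists (e / (2 * C))%R => // v _ vr.
have qr : qN m G (v \- u)%R <= ((e / (2 * C)) ^+ 2)%:E.
  rewrite -lee_sqrt ?lee_fin ?sqr_ge0// EFin_expe sqrte_sqr.
  by rewrite gee0_abs ?lee_fin ltW.
apply: (@le_lt_trans _ _ (e / 2)%:E); last by rewrite lte_fin; lra.
apply: linfty_norm_le => [|x]; first by lra.
apply: le_trans (qC _ _ x qr) _.
have -> : (C * (e / (2 * C)) ^+ 2 = C^-1 * (e / 2) ^+ 2)%R.
  by field; rewrite gt_eqF.
by rewrite ler_piMl ?sqr_ge0// invf_le1.
Qed.
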